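(* Let $X$ be a Helly graph with finite combinatorial dimension. Then every automorphism of $X$ is either elliptic or hyperbolic. Moreover, every automorphism $g$ of $X$ has a non-empty minimal set in $E(X)$, i.e. the function $p\mapsto d(g\cdot p,p)$ on $E(X)$ attains its infimum.
   Context: A graph is identified with its vertex set, with graph metric $d$; a connected graph is Helly if every family of pairwise intersecting combinatorial balls $B(x,r)=\{y:d(x,y)\le r\}$ has non-empty intersection. The injective hull: $E(X)=\{f:X\to\mathbb{R} \mid f(x)+f(y)\ge d(x,y)\ \forall x,y,\ f(x)=\sup_y (d(x,y)-f(y))\ \forall x\}$ with sup metric; automorphisms act by $(g\cdot f)(x)=f(g^{-1}x)$; the combinatorial dimension of $X$ is $\dim E(X)$. An automorphism $g$ of $X$ is elliptic if it has bounded orbits in $X$, and hyperbolic if for some vertex $x$ the map $n\in\mathbb{Z}\mapsto g^n\cdot x\in X$ is a quasi-isometric embedding. *)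

(* Defs.v *)
From HB Require Import structures.
From mathcomp Require Import all_boot all_order all_algebra.
From mathcomp Require Import all_classical all_reals all_analysis.
From mathcomp Require Import lra.

Set Implicit Arguments.
Unset Strict Implicit.
Unset Printing Implicit Defensive.

Import Order.TTheory GRing.Theory Num.Theory.

Local Open Scope classical_set_scope.
Local Open Scope ring_scope.

Fixpoint walk (V : Type) (adj : V -> V -> Prop) (n : nat) (x y : V) : Prop :=
  if n is m.+1 then exists z, adj x z /\ walk adj m z y else x = y.

Record connected_graph := ConnectedGraph {
  vertex :> Type ;
  adj : vertex -> vertex -> Prop ;
  adj_sym : forall x y, adj x y -> adj y x ;
  adj_irrefl : forall x, ~ adj x x ;
  adj_connected : forall x y, exists n, walk adj n x y }.

Section graph_metric.
Variable X : connected_graph.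
Implicit Types x y z : X.

Lemma exists_walk x y : exists n, `[< walk (@adj X) n x y >].
Proof. by have [n w] := adj_connected x y; exists n; apply/asboolP. Qed.

Definition gdist x y : nat := ex_minn (exists_walk x y).

Lemma gdist_walk x y : walk (@adj X) (gdist x y) x y.
Proof. by rewrite /gdist; case: ex_minnP => n /asboolP. Qed.

Lemma gdist_le n x y : walk (@adj X) n x y -> (gdist x y <= n)%N.
Proof. by rewrite /gdist; case: ex_minnP => m _ mP w; apply/mP/asboolP. Qed.

Lemma walk_cat m n x y z :
  walk (@adj X) m x y -> walk (@adj X) n y z -> walk (@adj X) (m + n) x z.
Proof.
elim: m x => [x -> //|m IH x [t [xt ty]] yz].
by exists t; split => //; exact: IH.
Qed.

Lemma walk_sym n x y : walk (@adj X) n x y -> walk (@adj X) n y x.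
Proof.
elim: n x => [x -> //|n IH x [t [xt ty]]].
rewrite -addn1; apply: (walk_cat (IH _ ty)).
by exists x; split => //; exact: adj_sym.
Qed.

Lemma gdistxx x : gdist x x = 0%N.
Proof. by apply/eqP; rewrite -leqn0; exact: gdist_le. Qed.

Lemma gdist_eq0 x y : gdist x y = 0%N -> x = y.
Proof. by move=> h; have := gdist_walk x y; rewrite h. Qed.

Lemma gdistC x y : gdist x y = gdist y x.
Proof.
by apply/eqP; rewrite eqn_leq; apply/andP; split;
  apply/gdist_le/walk_sym/gdist_walk.
Qed.

Lemma gdist_triangle y x z : (gdist x z <= gdist x y + gdist y z)%N.
Proof. by apply: gdist_le; apply: walk_cat; exact: gdist_walk. Qed.

Definition gball x (r : nat) : set X := [set y | (gdist x y <= r)%N].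

(* The empty family of balls is allowed, so a Helly graph is non-empty. *)
Definition helly_graph : Prop :=
  forall F : set (X * nat),
    (forall a b, F a -> F b -> gball a.1 a.2 `&` gball b.1 b.2 !=set0) ->
    \bigcap_(a in F) gball a.1 a.2 !=set0.

Record graph_aut := GraphAut {
  aut_fun :> X -> X ;
  aut_inv : X -> X ;
  aut_funK : cancel aut_fun aut_inv ;
  aut_invK : cancel aut_inv aut_fun ;
  aut_adj : forall x y, adj (aut_fun x) (aut_fun y) <-> adj x y }.

Definition aut_iter (g : graph_aut) (n : int) : X -> X :=
  match n with
  | Posz k => iter k g
  | Negz k => iter k.+1 (aut_inv g)
  end.

Lemma aut_invadj (g : graph_aut) x y :
  adj x y -> adj (aut_inv g x) (aut_inv g y).
Proof. by move=> xy; apply/(aut_adj g); rewrite !aut_invK. Qed.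

Lemma walk_map (h : X -> X) : (forall x y, adj x y -> adj (h x) (h y)) ->
  forall n x y, walk (@adj X) n x y -> walk (@adj X) n (h x) (h y).
Proof.
move=> hadj; elim=> [x y -> //|n IH x y [z [xz zy]]].
by exists (h z); split; [exact: hadj|exact: IH].
Qed.

Lemma gdist_aut (g : graph_aut) x y : gdist (g x) (g y) = gdist x y.
Proof.
apply/eqP; rewrite eqn_leq; apply/andP; split.
  apply: gdist_le; apply: (walk_map _ (gdist_walk x y)) => a b.
  by move=> /(aut_adj g).
rewrite -{1}(aut_funK g x) -{1}(aut_funK g y).
by apply/gdist_le/(walk_map (@aut_invadj g))/gdist_walk.
Qed.

Definition elliptic (g : graph_aut) : Prop :=
  forall x, exists K : nat, forall m n : int,
    (gdist (aut_iter g m x) (aut_iter g n x) <= K)%N.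

Definition qi_embedding (R : realType) (phi : int -> X) : Prop :=
  exists L C : R, [/\ 1 <= L, 0 <= C &
    forall m n : int,
      L^-1 * `|m - n|%:~R - C <= (gdist (phi m) (phi n))%:R
                              <= L * `|m - n|%:~R + C].

Definition hyperbolic (R : realType) (g : graph_aut) : Prop :=
  exists x, qi_embedding R (fun n => aut_iter g n x).

End graph_metric.

Section injective_hull.
Variables (R : realType) (X : connected_graph).

(* The supremum in hull_sup is a genuine one when X is non-empty: by hull_ge
   the range is bounded above by f x. *)
Record injective_hull := InjectiveHull {
  hull_fun :> X -> R ;
  hull_ge : forall x y, (gdist x y)%:R <= hull_fun x + hull_fun y ;
  hull_sup : forall x,
    hull_fun x = sup (range (fun y => (gdist x y)%:R - hull_fun y)) }.

HB.instance Definition _ := gen_eqMixin injective_hull.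
HB.instance Definition _ := gen_choiceMixin injective_hull.

Implicit Types f g h : injective_hull.

Lemma hull_eq f g : (forall x, f x = g x) -> f = g.
Proof.
case: f g => [f f1 f2] [g g1 g2] /= /funext fg.
by case: _ / fg g1 g2 => g1 g2; congr InjectiveHull; exact: Prop_irrelevance.
Qed.

Lemma hull_lipschitz f x y : f x <= (gdist x y)%:R + f y.
Proof.
rewrite (hull_sup f x); apply: ge_sup; first by exists ((gdist x x)%:R - f x), x.
move=> _ [z _ <-]; rewrite lerBlDr -addrA.
apply: (le_trans (y := (gdist x y + gdist y z)%:R)).
  by rewrite ler_nat; exact: gdist_triangle.
by rewrite natrD lerD2l; exact: hull_ge.
Qed.

Definition hull_dist f g : R := sup (range (fun x => `|f x - g x|)).

Lemma hull_dist_bounded f g : has_ubound (range (fun x => `|f x - g x|)).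
Proof.
have [[x0 _]|X0] := pselect (exists x : X, True); last first.
  by exists 0 => y [x]; case: X0; exists x.
have key (u v : injective_hull) x : u x - v x <= u x0 + v x0 :> R.
  have := hull_lipschitz u x x0; have := hull_ge v x x0; lra.
exists (f x0 + g x0) => _ [x _ <-].
have := key f g x; have := key g f x; rewrite ler_norml => *.
by apply/andP; split; lra.
Qed.

Lemma hull_dist_ge f g x : `|f x - g x| <= hull_dist f g.
Proof. by apply: ub_le_sup; [exact: hull_dist_bounded|exists x]. Qed.

Lemma hull_dist_le f g (c : R) : 0 <= c -> (forall x, `|f x - g x| <= c) ->
  hull_dist f g <= c.
Proof.
move=> c0 fgc.
have [N0|E] := pselect (range (fun x => `|f x - g x|) !=set0).
  by apply: ge_sup => // _ [x _ <-].
rewrite /hull_dist [X in sup X](_ : _ = set0) ?sup0//.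
by apply/seteqP; split=> // y yE; apply: E; exists y.
Qed.

Lemma hull_dist_ge0 f g : 0 <= hull_dist f g.
Proof.
have [[x _]|X0] := pselect (exists x : X, True).
  exact: le_trans (hull_dist_ge f g x).
rewrite /hull_dist [X in sup X](_ : _ = set0) ?sup0//.
by rewrite -subset0 => y [x]; case: X0; exists x.
Qed.

Lemma hull_distxx f : hull_dist f f = 0.
Proof.
apply/eqP; rewrite eq_le hull_dist_ge0 andbT.
by apply: hull_dist_le => // x; rewrite subrr normr0.
Qed.

Lemma hull_dist_eq0 f g : hull_dist f g = 0 -> f = g.
Proof.
move=> fg0; apply: hull_eq => x; apply/eqP.
by rewrite -subr_eq0 -normr_le0 -fg0 hull_dist_ge.
Qed.

Lemma hull_distC f g : hull_dist f g = hull_dist g f.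
Proof.
rewrite /hull_dist (_ : (fun x => `|f x - g x|) = fun x => `|g x - f x|)//.
by apply/funext => x; rewrite distrC.
Qed.

Lemma hull_dist_triangle g f h :
  hull_dist f h <= hull_dist f g + hull_dist g h.
Proof.
apply: hull_dist_le => [|x]; first by rewrite addr_ge0 ?hull_dist_ge0.
apply: le_trans (ler_distD (g x) _ _) _.
by rewrite lerD ?hull_dist_ge.
Qed.

HB.instance Definition _ := isMetric.Build R injective_hull
  hull_distxx hull_dist_eq0 hull_distC hull_dist_triangle.

Section action.
Variables (a : graph_aut X) (f : injective_hull).

Let af (x : X) : R := f (aut_inv a x).

Lemma hull_act_ge x y : (gdist x y)%:R <= af x + af y.
Proof. by rewrite -{1}(aut_invK a x) -{1}(aut_invK a y) gdist_aut hull_ge. Qed.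

Lemma hull_act_sup x : af x = sup (range (fun y => (gdist x y)%:R - af y)).
Proof.
rewrite /af hull_sup; congr sup; apply/seteqP; split => _ [y _ <-].
  by exists (a y) => //; rewrite aut_funK -{1}(aut_invK a x) gdist_aut.
exists (aut_inv a y) => //.
by rewrite -(gdist_aut a) !aut_invK.
Qed.

Definition hull_act : injective_hull := InjectiveHull hull_act_ge hull_act_sup.

End action.

Definition displacement (a : graph_aut X) (p : injective_hull) : R :=
  mdist (hull_act a p) p.

Definition minimal_set (a : graph_aut X) : set injective_hull :=
  [set p | displacement a p = inf (range (displacement a))].

End injective_hull.

Arguments minimal_set R [X] a.

(* Lebesgue covering dimension at most n: every open cover has an open
   refinement such that every point lies in at most n + 1 of its members. *)
Definition covering_dim_le (T : topologicalType) (n : nat) : Prop :=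
  forall U : set (set T), (forall u, U u -> open u) ->
    \bigcup_(u in U) u = [set: T] ->
  exists V : set (set T), [/\ forall v, V v -> open v,
    \bigcup_(v in V) v = [set: T],
    forall v, V v -> exists2 u, U u & v `<=` u &
    forall p : T, ([set v | V v /\ v p] #<= `I_n.+1)%card].

Definition finite_combinatorial_dim (R : realType) (X : connected_graph) :
    Prop :=
  exists n, covering_dim_le (injective_hull R X) n.

(* Main.v *)
(* Call phi : R -> R a folding map if it is nondecreasing, odd and commutes
   with a |-> a + 1. Since distances are integers, phi(d - a) = d - phi(a) for
   every distance d, so post-composition with phi preserves the inequality
   d(x, y) <= p(x) + p(y), and also extremality of p if phi is Lipschitz or if
   the supremum defining extremality is attained; it commutes with automorphisms.

   If some p in E(X) had more than N values modulo the group generated by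
   a |-> a + 1 and a |-> - a, other than those of 0 and 1/2, then moving them
   independently by piecewise linear folding maps would embed an
   (N+1)-dimensional cube in E(X). This contradicts the covering dimension,
   by Lebesgue's covering theorem, which follows from a cubical Sperner lemma
   proved with mod 2 cochains. So p has at most N such values c_j, and moving
   them to w_j in [0, 1/2]^N gives points of E(X) whose displacement depends
   only on w and on one of finitely many combinatorial types; a type that
   occurs for displacements arbitrarily close to the infimum is minimized by
   compactness of the cube.

   If the minimum L is 0, a fixed point of E(X) bounds the orbits. If L > 0,
   averaging a minimizer p over p, g p, ..., g^(n-1) p and retracting
   equivariantly onto E(X) gives a point displaced by at most d(g^n p, p) / n,
   hence d(g^n p, p) >= n L. *)
Require Import Defs.
From mathcomp Require Import all_boot all_order all_algebra.
From mathcomp Require Import all_classical all_reals all_analysis.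
From mathcomp Require Import lra zify.

Set Implicit Arguments.
Unset Strict Implicit.
Unset Printing Implicit Defensive.

Local Open Scope classical_set_scope.

(** * Mod 2 cochains and a cubical Sperner lemma *)

(** Cochains are functions on ordered simplices, listed by their vertices. This sums [phi] mod 2
    over the faces of [v], one entry deleted at a time. *)
Fixpoint coboundary (T : Type) (phi : seq T -> bool) (v : seq T) : bool :=
  if v is x :: w then phi w (+) coboundary (fun w' => phi (x :: w')) w
  else false.

(** The prism operator: [phi] is summed over the simplices a v_0, ..., a v_i, b v_i, ..., b v_k. *)
Fixpoint prism (T : Type) (a b : T -> T) (phi : seq T -> bool) (v : seq T) :
    bool :=
  if v is x :: w then
    phi (a x :: b x :: map b w) (+) prism a b (fun w' => phi (a x :: w')) w
  else false.

Section cochains.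
Variable T : Type.
Implicit Types (phi psi : seq T -> bool) (v : seq T) (a b : T -> T).

Lemma coboundaryD phi psi v :
  coboundary (fun w => phi w (+) psi w) v = coboundary phi v (+) coboundary psi v.
Proof. by elim: v phi psi => //= x v IH phi psi; rewrite IH addbACA. Qed.

Lemma prismD a b phi psi v :
  prism a b (fun w => phi w (+) psi w) v = prism a b phi v (+) prism a b psi v.
Proof. by elim: v phi psi => //= x v IH phi psi; rewrite IH addbACA. Qed.

Lemma coboundary_map (U : Type) (phi : seq U -> bool) (a : T -> U) v :
  coboundary (fun w => phi (map a w)) v = coboundary phi (map a v).
Proof.
by elim: v phi => //= x v IH phi; rewrite (IH (fun w => phi (a x :: w))).
Qed.

(** The usual cochain homotopy between the pullbacks along [a] and [b]; inner faces cancel mod 2. *)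
Lemma prism_coboundary a b phi v :
  prism a b (coboundary phi) v =
  phi (map b v) (+) phi (map a v) (+) coboundary (prism a b phi) v.
Proof.
elim: v phi => [|x v IH] phi /=; first by rewrite addbb.
rewrite prismD IH coboundaryD (coboundary_map (fun w => phi [:: a x, b x & w])).
set p := prism a b phi v; set q := coboundary (prism _ _ _) v.
set r := coboundary _ (map b v); set s := phi _; set t := phi _.
by set u := phi _; case: p q r s t u => [] [] [] [] [] [].
Qed.

Lemma coboundary0 v : coboundary (fun=> false) v = false.
Proof. by elim: v. Qed.

Lemma coboundary_sum m (phi : 'I_m -> seq T -> bool) v :
  coboundary (fun w => \big[addb/false]_(t < m) phi t w) v =
  \big[addb/false]_(t < m) coboundary (phi t) v.
Proof.
elim: m phi => [|m IH] phi; last first.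
  rewrite big_ord_recl -IH -coboundaryD; congr coboundary.
  by apply/funext => w; rewrite big_ord_recl.
rewrite big_ord0 -[RHS](coboundary0 v); congr coboundary.
by apply/funext => w; rewrite big_ord0.
Qed.

End cochains.

Lemma eq_prism (T : eqType) (a b : T -> T) (phi psi : seq T -> bool) (v : seq T) :
  (forall w, size w = (size v).+1 ->
    {in w, forall y, exists2 x, x \in v & y = a x \/ y = b x} ->
    phi w = psi w) ->
  prism a b phi v = prism a b psi v.
Proof.
elim: v phi psi => //= x v IH phi psi eq_phi; congr addb.
  apply: eq_phi => [|y]; first by rewrite /= size_map.
  rewrite !inE => /or3P[/eqP->|/eqP->|/mapP[z zv ->]].
  - by exists x; [rewrite inE eqxx|left].
  - by exists x; [rewrite inE eqxx|right].
  - by exists z; [rewrite inE zv orbT|right].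
apply: IH => w sw wv; apply: eq_phi => [|y]; first by rewrite /= sw.
rewrite inE => /predU1P[->|/wv[z zv yz]].
  by exists x; [rewrite inE eqxx|left].
by exists z => //; rewrite inE zv orbT.
Qed.

(** * Triangulated grids and their Stokes formula *)

Section cube.
Variable m : nat.
Implicit Types (phi psi : seq (nat -> nat) -> bool) (v : seq (nat -> nat)).

(* Points of the n-dimensional grid {0..m}^n are functions vanishing from the
   index n on. *)
Definition grid (n : nat) (p : nat -> nat) : Prop :=
  forall i, (p i <= m)%N /\ (n <= i -> p i = 0).

(** The common unit cube with lowest corner [b] is what gives a cell its small diameter in the
    covering argument. *)
Definition cell (n : nat) (v : seq (nat -> nat)) : Prop :=
  [/\ size v = n.+1, {in v, forall p, grid n p} &
    exists b : nat -> nat, {in v, forall p i, b i <= p i <= (b i).+1}].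

Definition set_coord (k t : nat) (p : nat -> nat) : nat -> nat :=
  fun i => if i == k then t else p i.

(** Product with the interval [0, m], cut into [m] unit slabs in direction [k]. *)
Definition prism_sum (k : nat) phi v : bool :=
  \big[addb/false]_(t < m) prism (set_coord k t) (set_coord k t.+1) phi v.

(* Evaluation of a mod 2 cochain on the fundamental chain of the cube,
   triangulated by iterated prisms. *)
Fixpoint cube_sum (n : nat) phi : bool :=
  if n is k.+1 then cube_sum k (prism_sum k phi) else phi [:: fun=> 0].

(** The chain evaluated by [cube_sum] consists of cells: a prism over a cell in slab [t] stays in
    one unit cube. *)
Lemma eq_cube_sum n phi psi :
  (forall v, cell n v -> phi v = psi v) -> cube_sum n phi = cube_sum n psi.
Proof.
elim: n phi psi => [|n IH] phi psi eq_phi /=.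
  apply: eq_phi; split=> // [p|]; first by rewrite inE => /eqP-> i.
  by exists (fun=> 0) => p; rewrite inE => /eqP->.
apply: IH => v [sv gv [b bv]]; apply: eq_bigr => t _; apply: eq_prism => w sw wv.
apply: eq_phi; split=> [|y /wv[x xv yx] i|]; first by rewrite sw sv.
  have [xm x0] := gv x xv i; have tm := ltn_ord t.
  case: yx => ->; rewrite /set_coord; case: eqP => [->|_].
  - by rewrite ltnn (ltnW tm).
  - by split=> // ni; apply/x0/ltnW.
  - by rewrite ltnn tm.
  - by split=> // ni; apply/x0/ltnW.
exists (set_coord n t b) => y /wv[x xv yx] i; have bx := bv x xv i.
by case: yx => ->; rewrite /set_coord; case: eqP => // _; rewrite leqnn leqnSn.
Qed.

Lemma cube_sum0 n : cube_sum n (fun=> false) = false.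
Proof.
elim: n => //= n IH; rewrite -[RHS]IH; congr cube_sum; apply/funext => v.
rewrite /prism_sum big1// => t _.
by elim: v => //= x v ->.
Qed.

Lemma cube_sumD n phi psi :
  cube_sum n (fun v => phi v (+) psi v) = cube_sum n phi (+) cube_sum n psi.
Proof.
elim: n phi psi => //= n IH phi psi; rewrite -IH; congr cube_sum.
apply/funext => v; rewrite /prism_sum -big_split /=; apply: eq_bigr => t _.
exact: prismD.
Qed.

Lemma cube_sum_exists n phi : cube_sum n phi -> exists2 v, cell n v & phi v.
Proof.
move=> s; apply: contrapT => nv; move: s; rewrite (@eq_cube_sum n _ (fun=> false)).
  by rewrite cube_sum0.
by move=> v cv; apply/negP => phiv; apply: nv; exists v.
Qed.

(** The homotopies of consecutive slabs telescope, which leaves the two extreme faces in direction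
    [k]. *)
Lemma prism_sum_coboundary k phi v :
  prism_sum k (coboundary phi) v =
  phi (map (set_coord k m) v) (+) phi (map (set_coord k 0) v) (+)
  coboundary (prism_sum k phi) v.
Proof.
rewrite /prism_sum coboundary_sum.
under eq_bigr do rewrite prism_coboundary.
rewrite big_split /=; congr addb.
elim: m => [|j IH]; first by rewrite big_ord0 addbb.
rewrite big_ord_recr /= IH; set x := phi _; set y := phi _; set z := phi _.
by case: x y z => [] [] [].
Qed.

Lemma grid_set_coord n k p : k <= m -> grid n p -> grid n.+1 (set_coord n k p).
Proof.
move=> km gp i; rewrite /set_coord; case: eqP => [->|_]; first by rewrite ltnn.
by have [pm p0] := gp i; split=> // ni; apply/p0/ltnW.
Qed.

Lemma prism_sum_eq0 n (Q : (nat -> nat) -> Prop) phi v :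
  (forall w, {in w, forall p, Q p} -> phi w = false) ->
  {in v, forall p k, k <= m -> Q (set_coord n k p)} -> prism_sum n phi v = false.
Proof.
move=> phi0 vQ; rewrite /prism_sum big1// => t _.
transitivity (prism (set_coord n t) (set_coord n t.+1) (fun=> false) v).
  apply: eq_prism => w _ wv; apply: phi0 => y /wv[x xv [] ->].
    by apply: vQ => //; exact: ltnW.
  exact: vQ.
by elim: v {vQ} => //= x v ->.
Qed.

(** Stokes' formula for a cochain vanishing on the side faces. The homotopy formula in the last
    direction leaves the coboundary of [prism_sum]; the induction hypothesis evaluates it on prisms
    over faces of the lower cube, which lie in side faces. *)
Lemma cube_sum_stokes n phi :
  (forall i j v, i < n -> j = 0 \/ j = m ->
    {in v, forall p, grid n.+1 p /\ p i = j} -> phi v = false) ->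
  cube_sum n.+1 (coboundary phi) =
  cube_sum n (phi \o map (set_coord n m)) (+)
  cube_sum n (phi \o map (set_coord n 0)).
Proof.
elim: n phi => [|n IH] phi phi0.
  rewrite /= prism_sum_coboundary; set e := coboundary _ _.
  suff -> : e = false by rewrite addbF.
  by rewrite /e /= /prism_sum big1.
rewrite -[LHS]/(cube_sum n.+1 (prism_sum n.+1 (coboundary phi))).
transitivity (cube_sum n.+1 (fun v => phi (map (set_coord n.+1 m) v) (+)
    phi (map (set_coord n.+1 0) v) (+) coboundary (prism_sum n.+1 phi) v)).
  by apply: eq_cube_sum => v _; exact: prism_sum_coboundary.
rewrite !cube_sumD [X in _ (+) X](_ : _ = false) ?addbF//.
have face0 i j v : i < n.+1 -> j = 0 \/ j = m ->
    {in v, forall p, grid n.+1 p /\ p i = j} -> prism_sum n.+1 phi v = false.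
  move=> ni j0m gv.
  apply: (@prism_sum_eq0 _ (fun p => grid n.+2 p /\ p i = j)) => [w|p pv k km].
    exact: phi0.
  have [gp pi] := gv p pv; split; first exact: grid_set_coord.
  by rewrite /set_coord ltn_eqF.
rewrite IH; last by move=> i j v ni; apply: face0; exact: ltnW.
have top_bot j : j = 0 \/ j = m ->
    cube_sum n (prism_sum n.+1 phi \o map (set_coord n j)) = false.
  move=> j0m; rewrite (@eq_cube_sum n _ (fun=> false)) ?cube_sum0//.
  move=> v [_ gv _]; apply: (face0 n j) => // _ /mapP[p pv ->].
  rewrite /set_coord eqxx; split=> //; apply: grid_set_coord; last exact: gv.
  by case: j0m => ->.
by rewrite !top_bot//; [left|right].
Qed.

End cube.

(** The prefix [c] of entries already passed carries the induction: deleting [x] leaves an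
    arrangement of [I] exactly when the whole is one of [x :: I]. *)
Lemma coboundary_perm (s I : seq nat) (c : seq nat) :
  coboundary (fun w => perm_eq (c ++ w) I) s =
  odd (count (fun x => perm_eq (c ++ s) (x :: I)) s).
Proof.
elim: s c => //= x s IH c; rewrite oddD oddb; congr addb.
  have /permPl-> : perm_eq (c ++ x :: s) (x :: c ++ s).
    by rewrite -(cat1s x s) perm_catCA.
  by rewrite perm_cons.
by have := IH (rcons c x); rewrite cat_rcons => <-; congr coboundary;
  apply/funext => w; rewrite cat_rcons.
Qed.

(** The parity count of Sperner's lemma. Labels forming [iota 0 n] plus one label [x] give one full
    face if [x = n] and two, deleting either copy of [x], if [x < n]; other labels give none. *)
Lemma coboundary_perm_iota n (s : seq nat) : size s = n.+1 ->
  {in s, forall x, x <= n} ->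
  coboundary (fun w => perm_eq w (iota 0 n)) s = perm_eq s (iota 0 n.+1).
Proof.
move=> ss sn; set I := iota 0 n.+1.
have /= -> := coboundary_perm s (iota 0 n) [::].
have iotaS : perm_eq (n :: iota 0 n) I.
  by rewrite /I -addn1 iotaD /= add0n cats1 perm_sym perm_rcons.
have [/hasP[x xs px]|/hasPn nop] :=
    boolP (has (fun x => perm_eq s (x :: iota 0 n)) s); last first.
  rewrite (@eq_in_count _ _ pred0) ?count_pred0; last first.
    by move=> x xs /=; apply/negbTE/nop.
  apply/esym/negbTE/negP => ps; have /nop/negP[] : n \in s.
    by rewrite (perm_mem ps) mem_iota add0n leqnn.
  by apply: perm_trans ps _; rewrite perm_sym.
rewrite (@eq_in_count _ _ (pred1 x)); last first.
  move=> y ys /=; apply/idP/eqP => [py|->//].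
  have : perm_eq (y :: iota 0 n) (x :: iota 0 n).
    by apply: perm_trans px; rewrite perm_sym.
  move=> /permP/(_ (pred1 x)) /=; rewrite eqxx; case: (eqVneq y x) => //= _.
  by move=> /eqP; rewrite eqn_add2r.
have /permP -> := px; rewrite /= eqxx count_uniq_mem ?iota_uniq// mem_iota add0n.
move: (sn x xs); rewrite leq_eqVlt => /predU1P[xn|lt_xn].
  by rewrite xn ltnn /=; apply/esym/(perm_trans px); rewrite xn.
rewrite lt_xn; apply/esym/negbTE/negP => ps.
have /permP/(_ (pred1 x)) : perm_eq (x :: iota 0 n) (n :: iota 0 n).
  by rewrite perm_sym in px; apply/(perm_trans px)/(perm_trans ps); rewrite perm_sym.
by rewrite /= eqxx gtn_eqF// => /eqP; rewrite eqn_add2r.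
Qed.

(** * Sperner's lemma by induction on the dimension *)

Section sperner.
Variables (m N : nat) (lab : (nat -> nat) -> nat).
Hypothesis lab_low : forall p i, grid m N p -> p i = 0 -> lab p <= i.
Hypothesis lab_high : forall p i, grid m N p -> p i = m -> lab p != i.

Let full n v := perm_eq (map lab v) (iota 0 n).

Lemma grid_le k n p : k <= n -> grid m k p -> grid m n p.
Proof.
by move=> kn gp i; have [pm p0] := gp i; split=> // /(leq_trans kn)/p0.
Qed.

(** In the step, the indicator of full cells is the coboundary of the indicator for labels 0 to [n].
    The boundary conditions exclude such faces except where coordinate [n] is 0, which is the cube
    one dimension below. *)
Lemma cube_sum_full n : n <= N -> cube_sum m n (full n.+1).
Proof.
elim: n => [_|n IH nN].
  rewrite /full /= (_ : lab _ = 0) //; apply/eqP; rewrite -leqn0.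
  by apply: lab_low => // i; split.
rewrite (@eq_cube_sum m n.+1 _ (coboundary (full n.+1))); last first.
  move=> v [sv gv _]; rewrite /full.
  rewrite (coboundary_map (fun w => perm_eq w (iota 0 n.+1)) lab).
  rewrite coboundary_perm_iota ?size_map// => _ /mapP[p pv ->].
  apply: lab_low; first exact: grid_le (gv p pv).
  by have [_ ->] := gv p pv n.+1.
(* Label [i] is missing where [p i = m], and label [n] where [p i = 0] with [i < n]. *)
have full0 i v : i <= n -> {in v, forall p, grid m n.+1 p /\ p i = m} \/
    i < n /\ {in v, forall p, grid m n.+1 p /\ p i = 0} -> full n.+1 v = false.
  move=> ni face; apply/negbTE/negP => /perm_mem pv.
  case: face => [fv|[lt_in fv]].
    have := pv i; rewrite mem_iota add0n ltnS ni /= => /mapP[p /fv[gp pi] ip].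
    by have := lab_high (grid_le nN gp) pi; rewrite -ip eqxx.
  have := pv n; rewrite mem_iota add0n ltnS leqnn /= => /mapP[p /fv[gp pi] np].
  by have := lab_low (grid_le nN gp) pi; rewrite -np leqNgt lt_in.
rewrite cube_sum_stokes => [|i j v ni]; last first.
  by case=> -> gv; apply: (full0 i) (ltnW ni) _; [right|left].
rewrite (@eq_cube_sum m n _ (fun=> false)); last first.
  move=> v [_ gv _]; apply: (full0 n) => //; left => _ /mapP[x /gv gx ->].
  by rewrite /set_coord eqxx; split=> //; exact: grid_set_coord.
rewrite cube_sum0 /= (@eq_cube_sum m n _ (full n.+1)); first exact/IH/ltnW.
move=> v [_ gv _] /=; rewrite -[in RHS](map_id v); congr full.
apply/eq_in_map => p pv; apply/funext => j; rewrite /set_coord.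
by case: eqP => // ->; have [_ ->] := gv p pv n.
Qed.

Lemma cubical_sperner :
  exists2 v, cell m N v & perm_eq (map lab v) (iota 0 N.+1).
Proof. exact/cube_sum_exists/cube_sum_full. Qed.

End sperner.

Import Order.TTheory GRing.Theory Num.Theory.
Import numFieldNormedType.Exports.

Local Open Scope ring_scope.

(** * Folding maps and the injective hull *)

Section fold.
Variable R : realType.
Implicit Types (a b r s : R) (u v : R -> R) (k : int).

Definition nearest_int a : int := Num.floor (a + 2^-1).
Definition dist_int a : R := `|a - (nearest_int a)%:~R|.
(* The odd map commuting with a |-> a + 1 that extends u : [0, 1/2] -> [0, 1/2]. *)
Definition fold u a : R :=
  (nearest_int a)%:~R + Num.sg (a - (nearest_int a)%:~R) * u (dist_int a).

Definition folding u : Prop := [/\ u 0 = 0, u 2^-1 = 2^-1 &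
  forall r s, 0 <= r -> r <= s -> s <= 2^-1 -> u r <= u s].

Lemma nearest_int_itv a :
  - 2^-1 <= a - (nearest_int a)%:~R < 2^-1.
Proof.
have := floor_itv (a + 2^-1); rewrite -/(nearest_int a) intrD => /andP[].
by set k := (nearest_int a)%:~R; move=> *; apply/andP; split; lra.
Qed.

Lemma dist_int_itv a : 0 <= dist_int a <= 2^-1.
Proof.
have /andP[? ?] := nearest_int_itv a.
by rewrite /dist_int normr_ge0 ler_norml; apply/andP; split; lra.
Qed.

Lemma nearest_int_eq a k : - 2^-1 <= a - k%:~R < 2^-1 -> nearest_int a = k.
Proof.
move=> /andP[? ?]; apply: floor_def.
by rewrite intrD; apply/andP; split; lra.
Qed.

Lemma foldDr u k r : folding u -> 0 <= r <= 2^-1 -> fold u (k%:~R + r) = k%:~R + u r.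
Proof.
move=> [u0 u2 _] /andP[r0]; rewrite le_eqVlt => /predU1P[->|r2].
  (* At [r = 2^-1] rounding goes up to [k + 1]; [u 2^-1 = 2^-1] reconciles the two expressions. *)
  rewrite /fold /dist_int (@nearest_int_eq _ (k + 1)) intrD; last first.
    by apply/andP; split; lra.
  have -> : k%:~R + 2^-1 - (k%:~R + 1) = - 2^-1 :> R by lra.
  by rewrite sgrN gtr0_sg ?normrN ?ger0_norm ?u2 ?invr_ge0 ?invr_gt0//; lra.
rewrite /fold /dist_int (@nearest_int_eq _ k) addrAC subrr add0r; last first.
  by apply/andP; split; lra.
move: r0; rewrite le_eqVlt => /predU1P[<-|r0]; first by rewrite sgr0 normr0 u0 mul0r.
by rewrite gtr0_sg// gtr0_norm// mul1r.
Qed.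

Lemma foldDl u k r : folding u -> 0 <= r <= 2^-1 -> fold u (k%:~R - r) = k%:~R - u r.
Proof.
move=> [u0 u2 _] /andP[r0 r2].
rewrite /fold /dist_int (@nearest_int_eq _ k) addrAC subrr add0r; last first.
  by apply/andP; split; lra.
move: r0; rewrite le_eqVlt => /predU1P[<-|r0].
  by rewrite oppr0 sgr0 normr0 u0 mul0r subr0 addr0.
by rewrite sgrN gtr0_sg// normrN gtr0_norm// mulN1r.
Qed.

Lemma dist_intP a : a = (nearest_int a)%:~R + dist_int a \/
  a = (nearest_int a)%:~R - dist_int a.
Proof.
rewrite /dist_int; set t := a - _; have at_ : a = (nearest_int a)%:~R + t.
  by rewrite /t; lra.
by case: (ger0P t) => _; [left|right]; rewrite ?opprK.
Qed.

Lemma foldP u a : folding u ->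
  let k := (nearest_int a)%:~R in let r := dist_int a in
  a = k + r /\ fold u a = k + u r \/ a = k - r /\ fold u a = k - u r.
Proof.
move=> fu /=; have ra := dist_int_itv a; have := dist_intP a.
move: (nearest_int a) (dist_int a) ra => k r ra [] ->; [left|right].
  by rewrite foldDr.
by rewrite foldDl.
Qed.

Lemma fold_intB u k a : folding u -> fold u (k%:~R - a) = k%:~R - fold u a.
Proof.
move=> fu; have ra := dist_int_itv a; have := foldP a fu.
move: (nearest_int a) (dist_int a) ra => j r ra /= [] [-> ->].
  have -> : k%:~R - (j%:~R + r) = (k - j)%:~R - r by rewrite intrB; lra.
  by rewrite foldDl// intrB; lra.
have -> : k%:~R - (j%:~R - r) = (k - j)%:~R + r by rewrite intrB; lra.
by rewrite foldDr// intrB; lra.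
Qed.

Lemma folding_itv u r : folding u -> 0 <= r <= 2^-1 -> 0 <= u r <= 2^-1.
Proof.
move=> [u0 u2 um] /andP[r0 r2]; apply/andP; split; first by rewrite -u0 um.
by rewrite -u2 um.
Qed.

Lemma fold_near u a : folding u ->
  (nearest_int a)%:~R - 2^-1 <= fold u a <= (nearest_int a)%:~R + 2^-1.
Proof.
move=> fu; have /andP[? ?] := folding_itv fu (dist_int_itv a).
by case: (foldP a fu) => -[_ ->]; apply/andP; split; lra.
Qed.

(** If the nearest integers differ, [fold_near] separates the values; otherwise [u] is monotone on
    either side of the common integer. *)
Lemma fold_le u a b : folding u -> a <= b -> fold u a <= fold u b.
Proof.
move=> fu ab; have [u0 u2 um] := fu.
have /andP[? ?] := nearest_int_itv a; have /andP[? ?] := nearest_int_itv b.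
have : (nearest_int a <= nearest_int b)%R by rewrite le_floor// lerD2r.
rewrite le_eqVlt => /predU1P[nab|]; last first.
  rewrite -(lezD1 (nearest_int a)) -(ler_int R) intrD => nab.
  have /andP[_ ?] := fold_near a fu; have /andP[? _] := fold_near b fu; lra.
have /andP[? ?] := folding_itv fu (dist_int_itv a).
have /andP[? ?] := folding_itv fu (dist_int_itv b).
have /andP[ra ra2] := dist_int_itv a; have /andP[rb rb2] := dist_int_itv b.
case: (foldP a fu) => -[aE ->]; case: (foldP b fu) => -[bE ->]; rewrite nab in aE *.
- by rewrite lerD2l um//; lra.
- have -> : dist_int a = 0 by lra.
  have -> : dist_int b = 0 by lra.
  by rewrite u0; lra.
- by lra.
- by rewrite lerD2l lerN2 um//; lra.
Qed.

(** The hypotheses make [u] nondecreasing and 2-Lipschitz. The folding map of [2 * r - u r] is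
    [2 * a - fold u a], and its monotonicity is the claim. *)
Lemma fold_sub u a b : folding u -> folding (fun r => 2 * r - u r) -> a <= b ->
  fold u b - fold u a <= 2 * (b - a).
Proof.
move=> fu fv ab; set v := fun r => 2 * r - u r.
have fvE c : fold v c = 2 * c - fold u c.
  have := dist_intP c; have ra := dist_int_itv c.
  move: (nearest_int c) (dist_int c) ra => k r ra [] ->.
    by rewrite !foldDr// /v; lra.
  by rewrite !foldDl// /v; lra.
by have := fold_le fv ab; rewrite !fvE; lra.
Qed.

End fold.

(** * Folding maps acting on the injective hull *)

Section hull.
Variables (R : realType) (X : connected_graph).
Implicit Types (p : injective_hull R X) (g : graph_aut X).

Lemma hull_near p x (e : R) : 0 < e -> exists y, p x + p y < (gdist x y)%:R + e.
Proof.
move=> e0; pose S := range (fun y => (gdist x y)%:R - p y).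
have pS : p x = sup S := hull_sup p x.
have hS : has_sup S.
  split; first by exists ((gdist x x)%:R - p x), x.
  by exists (p x) => _ [y _ <-]; rewrite lerBlDr; exact: hull_ge.
have [_ [y _ <-]] := sup_adherent e0 hS.
by rewrite -pS => ?; exists y; lra.
Qed.

Lemma hull_near_exists (f : X -> R) :
  (forall x y, (gdist x y)%:R <= f x + f y) ->
  (forall x e, 0 < e -> exists y, f x + f y < (gdist x y)%:R + e) ->
  exists p, p = f :> (X -> R).
Proof.
move=> f_ge f_near.
suff fS x : f x = sup (range (fun y => (gdist x y)%:R - f y)).
  by exists (InjectiveHull f_ge fS).
have ubS : ubound (range (fun y => (gdist x y)%:R - f y)) (f x).
  by move=> _ [y _ <-]; rewrite lerBlDr.
apply/eqP; rewrite eq_le; apply/andP; split; last first.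
  by apply: ge_sup => //; exists ((gdist x x)%:R - f x), x.
apply/ler_addgt0Pr => e e0; have [y fxy] := f_near x e e0.
rewrite (@le_trans _ _ ((gdist x y)%:R - f y + e))//; first by lra.
by rewrite lerD2r; apply: ub_le_sup; [exists (f x)|exists y].
Qed.

Lemma hull_fold_ge p u : folding u ->
  forall x y, (gdist x y)%:R <= fold u (p x) + fold u (p y).
Proof.
move=> fu x y; have := @fold_le _ u ((gdist x y)%:~R - p y) (p x) fu.
rewrite fold_intB// lerBlDr => /(_ (hull_ge p x y)).
by rewrite lerBlDr.
Qed.

Lemma hull_fold_lipschitz p u : folding u -> folding (fun r => 2 * r - u r) ->
  exists q : injective_hull R X, q = fold u \o p :> (X -> R).
Proof.
move=> fu fv; apply: hull_near_exists => [|x e e0]; first exact: hull_fold_ge.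
(* A 2-Lipschitz folding map at most doubles the excess over the distance. *)
have [|y pxy] := @hull_near p x (e / 2); first by rewrite divr_gt0.
exists y => /=; have pge := hull_ge p x y.
have : (gdist x y)%:~R - p y <= p x by rewrite -pmulrn; lra.
by move=> /(fold_sub fu fv); rewrite fold_intB// -pmulrn; lra.
Qed.

Definition tight p : Prop := forall x, exists y, p x + p y = (gdist x y)%:R.

(** An attained supremum stays attained under every folding map, continuous or not; this admits the
    step maps used below. *)
Lemma hull_fold_tight p u : tight p -> folding u ->
  exists q : injective_hull R X, q = fold u \o p :> (X -> R).
Proof.
move=> tp fu; apply: hull_near_exists => [|x e e0]; first exact: hull_fold_ge.
have [y pxy] := tp x; exists y => /=.
have -> : p x = (gdist x y)%:~R - p y by rewrite -pmulrn -pxy addrK.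
by rewrite fold_intB// -pmulrn subrK ltrDl.
Qed.

Lemma displacement_ge g p x : `|p (aut_inv g x) - p x| <= displacement g p.
Proof. exact: (hull_dist_ge (hull_act g p) p). Qed.

Lemma displacement_le g p (c : R) : 0 <= c ->
  (forall x, `|p (aut_inv g x) - p x| <= c) -> displacement g p <= c.
Proof. exact: (@hull_dist_le _ _ (hull_act g p) p). Qed.

Lemma displacement_ge0 g p : 0 <= displacement g p.
Proof. exact: (hull_dist_ge0 (hull_act g p) p). Qed.

End hull.

(** * Covering dimension of cubes *)

(** For empty [Q] both clauses are vacuous, so every set of a cover gets a label. *)
Lemma least_index (Q : nat -> Prop) : exists l,
  (forall i, Q i -> (l <= i)%N) /\ ((exists i, Q i) -> Q l).
Proof.
have [exQ|] := pselect (exists i, `[< Q i >]); last first.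
  by move=> nQ; exists 0%N; split=> // -[i Qi]; case: nQ; exists i; apply/asboolP.
case: (ex_minnP exQ) => l /asboolP Ql lmin; exists l; split=> // i Qi.
by apply: lmin; apply/asboolP.
Qed.

Section cube_covering.
Variables (R : realType) (T : metricType R) (n : nat).
Variables (tau del C : R) (iota : 'rV[R]_n -> T).
Hypotheses (tau0 : 0 < tau) (del0 : 0 < del) (C0 : 0 < C).

Definition box : set 'rV[R]_n := [set t | forall i, 0 <= t ord0 i <= tau].

Hypothesis iota_le : forall t s (e : R), box t -> box s ->
  (forall i, `|t ord0 i - s ord0 i| <= e) -> mdist (iota t) (iota s) <= C * e.
Hypothesis iota_ge : forall t s i, box t -> box s ->
  del * `|t ord0 i - s ord0 i| <= mdist (iota t) (iota s).

Lemma box_compact : compact box.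
Proof.
have := @rV_compact R n (fun=> `[0, tau]%classic) (fun=> @segment_compact R 0 tau).
by under [X in compact X -> _]eq_set do under eq_forall do rewrite /= in_itv /=.
Qed.

Lemma box_lebesgue_number (V : set (set T)) : (forall v, V v -> open v) ->
  \bigcup_(v in V) v = [set: T] ->
  exists2 lam : R, 0 < lam & forall t, box t ->
    exists2 v, V v & forall q, mdist (iota t) q < lam -> v q.
Proof.
move=> Vo Vcov.
pose P (e : R) t := exists2 v, V v & forall q, mdist (iota t) q < e -> v q.
suff boxP : \forall e \near 0^'+, box `<=` P e.
  have : \forall e \near 0^'+, 0 < e /\ box `<=` P e.
    near=> e; split; near: e; first exact: nbhs_right_gt.
    exact: boxP.
  by move=> /filter_ex[e [e0 eP]]; exists e.
have /compact_near_coveringP/near_covering_withinP cov := box_compact.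
apply: cov => t bt; have : (\bigcup_(v in V) v) (iota t) by rewrite Vcov.
move=> [v Vv vt]; have /nbhs_ballP[r /= r0 rv] : nbhs (iota t) v.
  by apply: open_nbhs_nbhs; split => //; exact: Vo.
have r20 : 0 < r / 2 by rewrite divr_gt0.
(* Half of the radius [r] absorbs the move from [t] to [s], the other half the distance to [q]. *)
exists (ball t (r / 2 / C), [set e | 0 < e < r / 2]) => /=.
  split; first by apply: nbhsx_ballx; rewrite divr_gt0.
  near=> e; apply/andP; split; near: e; first exact: nbhs_right_gt.
  exact: nbhs_right_lt.
move=> [s e] /= [ts /andP[e0 er]] bs; exists v => // q sq.
apply: rv; rewrite ballEmdist /=; apply: le_lt_trans (metric_triangle _ (iota s) _) _.
have : mdist (iota t) (iota s) <= C * (r / 2 / C).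
  by apply: iota_le => // i; have /ltW := ts.2 ord0 i.
by rewrite [C * _]mulrC divfK ?gt_eqF//; lra.
Unshelve. all: by end_near. Qed.

Definition grid_point (m : nat) (p : nat -> nat) : 'rV[R]_n :=
  \row_(i < n) (tau * (p i)%:R / m%:R).

Lemma grid_point_box m p : grid m n p -> box (grid_point m p).
Proof.
move=> gp i; rewrite mxE; have [pm _] := gp i.
rewrite !mulr_ge0 ?invr_ge0 ?(ltW tau0)//=.
case: m pm gp => [|m] pm gp; first by rewrite invr0 mulr0 ltW.
by rewrite ler_pdivrMr ?ltr0n// ler_pM2l// ler_nat.
Qed.

(** Lebesgue's covering theorem. A grid point is labelled by the first low face that its chosen set
    touches; small sets miss the opposite face, so Sperner's lemma yields a cell with labels 0 to
    [n]. The chosen sets of its vertices share a point by the Lebesgue number, and their labels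
    distinguish them. *)
Lemma cube_covering_order (V : set (set T)) :
  (forall v, V v -> open v) -> \bigcup_(v in V) v = [set: T] ->
  (forall v p q, V v -> v p -> v q -> mdist p q < del * tau) ->
  exists p, (`I_n.+1 #<= [set v | V v /\ v p])%card.
Proof.
move=> Vo Vcov Vsmall; have [lam lam0 lamP] := box_lebesgue_number Vo Vcov.
(* The mesh is chosen so that one grid step moves the image by less than [lam]. *)
pose m := (Num.bound (C * tau / lam)).+1.
have mlam : C * (tau / m%:R) < lam.
  have : C * tau / lam < m%:R.
    have /archi_boundP/lt_trans : 0 <= C * tau / lam.
      by rewrite !mulr_ge0 ?invr_ge0 ?ltW.
    by apply; rewrite ltr_nat.
  by rewrite ltr_pdivrMr// => ?; rewrite mulrA ltr_pdivrMr ?ltr0n// [ltRHS]mulrC.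
pose pt := grid_point m.
have /choice[vp vpP] : forall p, exists v, grid m n p ->
    V v /\ forall q, mdist (iota (pt p)) q < lam -> v q.
  move=> p; have [gp|] := pselect (grid m n p); last by exists set0.
  by have [v Vv vq] := lamP _ (grid_point_box gp); exists v.
have /choice[L LP] := fun v : set T => least_index (fun i =>
  exists p, [/\ grid m n p, p i = 0%N & v (iota (pt p))]).
have vpp p : grid m n p -> vp p (iota (pt p)).
  by move=> gp; apply: (vpP p gp).2; rewrite mdistxx.
have [p i gp pi|p i gp pi|w [sw gw [b bw]] Lw] :=
    @cubical_sperner m n (fun p => L (vp p)).
- by apply: (LP (vp p)).1; exists p; split => //; exact: vpp.
- apply/eqP => Li; have ni : (i < n)%N.
    by rewrite ltnNge; apply/negP => ni; have [_ /(_ ni)] := gp i; rewrite pi.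
  have [|q [gq]] := (LP (vp p)).2.
    (* Every grid point has coordinate [n] equal to 0, so the least index is attained. *)
    exists n, p; split => //; last exact: vpp.
    by have [_ /(_ (leqnn n))] := gp n.
  rewrite Li => qi /(Vsmall _ _ _ (vpP p gp).1 (vpp p gp)); rewrite ltNge => /negP; apply.
  apply: le_trans (iota_ge (Ordinal ni) (grid_point_box gp) (grid_point_box gq)).
  rewrite !mxE /= qi pi mulr0 mul0r subr0.
  by rewrite mulfK ?pnatr_eq0// gtr0_norm.
have : (0 < size w)%N by rewrite sw.
case: w sw gw bw Lw => // x w sw gw bw Lw _; exists (iota (pt x)).
apply: card_le_trans (card_image_le L _); apply: subset_card_le => i /= ni.
have : i \in [seq L (vp p) | p <- x :: w].
  by rewrite (perm_mem Lw) mem_iota.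
move=> /mapP[p pw ->]; exists (vp p) => //; split; first exact: (vpP p (gw p pw)).1.
apply: (vpP p (gw p pw)).2; apply: le_lt_trans mlam.
have xw : x \in x :: w by rewrite inE eqxx.
apply: iota_le; [exact/grid_point_box/gw|exact/grid_point_box/gw|move=> j].
have m0 : 0 < m%:R^-1 :> R by rewrite invr_gt0 ltr0n.
rewrite !mxE -mulrBl -mulrBr !normrM (gtr0_norm tau0) (gtr0_norm m0).
rewrite ler_pM2r// ger_pMr//.
have := bw p pw j; have := bw x xw j; move: (p j) (x j) (b j) => c d e.
move=> /andP[ed de] /andP[ec ce].
rewrite -!(ler_nat R) -!natr1 in ed de ec ce.
by rewrite ler_norml; apply/andP; split; lra.
Qed.

Lemma cube_covering_dim k : (k < n)%N -> ~ covering_dim_le T k.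
Proof.
(* Two points of a ball of radius [eta] are less than [del * tau] apart. *)
move=> kn dimT; pose eta := del * tau / 2.
have eta0 : 0 < eta by rewrite !mulr_gt0.
have [| |V [Vo Vcov Vsub Vcard]] := dimT [set (ball q eta)^° | q in [set: T]].
- by move=> _ [q _ <-]; exact: open_interior.
- apply/seteqP; split => // q _; exists (ball q eta)^°; first by exists q.
  exact: nbhsx_ballx.
have [v p q Vv vp vq|p] := cube_covering_order Vo Vcov.
  have [_ [x _ <-] vx] := Vsub v Vv.
  have := interior_subset (vx p vp); have := interior_subset (vx q vq).
  rewrite !ballEmdist /= => xq xp.
  have := metric_triangle p x q; rewrite (metric_sym p x) /eta in xq xp *; lra.
move=> /card_le_trans/(_ (Vcard p)); rewrite card_le_II.
by rewrite ltnS leqNgt kn.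
Qed.
End cube_covering.

(** * Values of a hull point modulo integers and sign *)

Lemma finite_pos_lbound (R : realType) (I : finType) (F : I -> R) :
  (forall i, 0 < F i) -> exists2 d : R, 0 < d & forall i, d <= F i.
Proof.
move=> F0; exists (\big[Num.min/1]_i F i); last first.
  by move=> i; exact: bigmin_le_cond.
by apply: (big_ind (fun d => 0 < d)) => // x y x0 y0; rewrite lt_min x0 y0.
Qed.

Lemma fold_dist_le (R : realType) (u v : R -> R) (a : R) :
  `|fold u a - fold v a| <= `|u (dist_int a) - v (dist_int a)|.
Proof.
rewrite /fold opprD addrACA subrr add0r -mulrBr normrM normr_sg.
by case: eqP => _; rewrite ?mul0r ?mul1r.
Qed.

Lemma fold_dist_eq (R : realType) (u v : R -> R) (a : R) : 0 < dist_int a ->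
  `|fold u a - fold v a| = `|u (dist_int a) - v (dist_int a)|.
Proof.
rewrite {1}/dist_int normr_gt0 => a0.
by rewrite /fold opprD addrACA subrr add0r -mulrBr normrM normr_sg a0 mul1r.
Qed.

(** * Independent perturbation of finitely many values *)

Section bumps.
Variables (R : realType) (n : nat) (r : 'I_n.+1 -> R) (d : R).
Hypotheses (d0 : 0 < d) (r0 : forall i, d <= r i) (r2 : forall i, r i <= 2^-1 - d).
Hypothesis rr : forall i j, i != j -> d <= `|r i - r j|.

(** Tents may overlap, but each vanishes at 0, at 1/2 and at the centres of the others. *)
Definition tent (i : 'I_n.+1) (s : R) : R := Num.max 0 (d - `|s - r i|).

Definition bump (t : 'rV[R]_n.+1) (s : R) : R :=
  s + \sum_i t ord0 i * tent i s.

Lemma tent_itv i s : 0 <= tent i s <= d.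
Proof.
rewrite /tent le_max lexx ge_max (ltW d0) /=.
by have := normr_ge0 (s - r i); lra.
Qed.

Lemma tent_eq0 i s : d <= `|s - r i| -> tent i s = 0.
Proof. by move=> ?; rewrite /tent max_l// subr_le0. Qed.

Lemma tent_lipschitz i s s' : `|tent i s - tent i s'| <= `|s - s'|.
Proof.
have := ler_dist_dist (s - r i) (s' - r i).
rewrite (_ : s - r i - (s' - r i) = s - s'); last by lra.
have := normr_ge0 (s - s'); rewrite !ler_norml /tent.
move: `|s - s'| `|s - r i| `|s' - r i| => c a b c0.
by case: (leP 0 (d - a)); case: (leP 0 (d - b)) => ? ? /andP[? ?];
  apply/andP; split; lra.
Qed.

(** Each of the [n.+1] tents is 1-Lipschitz with coefficient at most [n.+1%:R^-1]; hence [bump t] is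
    nondecreasing and 2-Lipschitz. *)
Lemma bump_sum t s s' : box n.+1%:R^-1 t -> s <= s' ->
  `|\sum_i t ord0 i * tent i s' - \sum_i t ord0 i * tent i s| <= s' - s.
Proof.
move=> bt ss'; rewrite -sumrB; apply: le_trans (ler_norm_sum _ _ _) _.
apply: le_trans (_ : _ <= \sum_(i < n.+1) n.+1%:R^-1 * (s' - s)) _.
  apply: ler_sum => i _; have /andP[t0 t1] := bt i.
  rewrite -mulrBr normrM ger0_norm//; apply: ler_pM => //.
  by apply: le_trans (tent_lipschitz _ _ _) _; rewrite ger0_norm ?subr_ge0.
by rewrite sumr_const card_ord -[leLHS]mulr_natl mulrA mulfV ?mul1r.
Qed.

Lemma bump_end t : bump t 0 = 0 /\ bump t 2^-1 = 2^-1.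
Proof.
by split; rewrite /bump big1 ?addr0// => i _; rewrite tent_eq0 ?mulr0//;
  have := r0 i; have := r2 i => ? ?; rewrite ler_normr; apply/orP; [right|left]; lra.
Qed.

Lemma bump_folding t : box n.+1%:R^-1 t ->
  folding (bump t) /\ folding (fun s => 2 * s - bump t s).
Proof.
move=> bt; have [b0 b2] := bump_end t.
split; split; rewrite ?b0 ?b2; [by []|by []| |lra|lra|]; move=> s s' _ ss' _;
  have := bump_sum bt ss'; rewrite /bump ler_norml => /andP[? ?]; lra.
Qed.

Lemma bump_le (t t' : 'rV[R]_n.+1) (e s : R) : (forall i, `|t ord0 i - t' ord0 i| <= e) ->
  `|bump t s - bump t' s| <= n.+1%:R * d * e.
Proof.
move=> te; rewrite /bump opprD addrACA subrr add0r -sumrB.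
apply: le_trans (ler_norm_sum _ _ _) _.
apply: le_trans (_ : _ <= \sum_(i < n.+1) e * d) _; last first.
  by rewrite sumr_const card_ord -[leLHS]mulr_natl [e * d]mulrC mulrA.
apply: ler_sum => i _; have /andP[? ?] := tent_itv i s.
by rewrite -mulrBl normrM; apply: ler_pM => //; rewrite ger0_norm.
Qed.

(** Only tent [i] is non-zero at its centre, so the cube coordinate can be read off there; this
    gives the lower bound for the embedding of the cube. *)
Lemma bump_center (t t' : 'rV[R]_n.+1) i : `|bump t (r i) - bump t' (r i)| =
  d * `|t ord0 i - t' ord0 i|.
Proof.
rewrite /bump opprD addrACA subrr add0r -sumrB (bigD1 i)//= big1 ?addr0.
  rewrite -mulrBl normrM mulrC /tent subrr normr0 subr0; congr (_ * _).
  by rewrite max_r ?(ltW d0)// gtr0_norm.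
by move=> j ji; rewrite tent_eq0 ?mulr0 ?subrr// rr// eq_sym.
Qed.

End bumps.

Section hull_values.
Variables (R : realType) (X : connected_graph) (N : nat).
Hypothesis dimN : covering_dim_le (injective_hull R X) N.
Implicit Types (p : injective_hull R X).

(* More than N values of dist_int \o p inside ]0, 1/2[ could be moved
   independently, which would embed a cube of dimension N+1 in the hull. *)
Lemma hull_values_bound p (x : 'I_N.+1 -> X) :
  (forall i, 0 < dist_int (p (x i)) < 2^-1) ->
  ~ injective (fun i => dist_int (p (x i))).
Proof.
move=> x_itv x_inj; set r := fun i => dist_int (p (x i)) in x_inj.
(* One [d] for all gaps: diagonal pairs bound the distance of a value to 0 and 1/2, other pairs the
   distance between two values. *)
have [|d d0 dP] := @finite_pos_lbound R ('I_N.+1 * 'I_N.+1)%type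
    (fun ij => if ij.1 == ij.2 then Num.min (r ij.1) (2^-1 - r ij.1)
               else `|r ij.1 - r ij.2|).
  move=> [i j] /=; case: eqP => [_|/eqP ij].
    by rewrite lt_min subr_gt0; exact: x_itv.
  by rewrite normr_gt0 subr_eq0; apply: contra ij => /eqP/x_inj->.
have r0 i : d <= r i by have := dP (i, i); rewrite /= eqxx le_min => /andP[].
have r2 i : r i <= 2^-1 - d.
  by have := dP (i, i); rewrite /= eqxx le_min => /andP[_]; lra.
have rr i j : i != j -> d <= `|r i - r j|.
  by move=> /negbTE ij; have := dP (i, j); rewrite /= ij.
have /choice[iota iotaE] : forall t : 'rV[R]_N.+1, exists q : injective_hull R X,
    box N.+1%:R^-1 t -> q = fold (bump r d t) \o p :> (X -> R).
  move=> t; have [bt|] := pselect (box N.+1%:R^-1 t); last by exists p.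
  have [f1 f2] := bump_folding r0 r2 bt.
  by have [q qE] := hull_fold_lipschitz p f1 f2; exists q.
have tau0 : 0 < N.+1%:R^-1 :> R by rewrite invr_gt0 ltr0n.
have C0 : 0 < N.+1%:R * d :> R by rewrite mulr_gt0// ltr0n.
apply: (cube_covering_dim (iota := iota) tau0 d0 C0 _ _ (ltnSn N)) dimN.
- move=> t s e bt bs te; apply: hull_dist_le => [|y].
    by rewrite mulr_ge0 ?(ltW C0)// (le_trans (normr_ge0 _) (te ord0)).
  rewrite (iotaE _ bt) (iotaE _ bs) /=.
  by apply: le_trans (fold_dist_le _ _ _) _; exact: bump_le.
- move=> t s i bt bs; apply: le_trans (hull_dist_ge _ _ (x i)).
  rewrite (iotaE _ bt) (iotaE _ bs) /= fold_dist_eq ?bump_center//.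
  by have /andP[] := x_itv i.
Qed.

Lemma finite_or_many (S : set R) n :
  (exists s : seq R, [/\ size s = n, uniq s & {in s, forall a, S a}]) \/
  (exists s : seq R, [/\ (size s < n)%N, {in s, forall a, S a} &
    forall a, S a -> a \in s]).
Proof.
elim: n => [|n [[s [sn us sS]]|[s [sn sS Ss]]]]; first by left; exists [::].
  have [[a [Sa as_]]|nos] := pselect (exists a, S a /\ a \notin s).
    left; exists (a :: s); split; rewrite /= ?sn ?as_//.
    by move=> b; rewrite inE => /predU1P[->//|/sS].
  right; exists s; split; rewrite ?sn// => a Sa; apply: contrapT => /negP as_.
  by apply: nos; exists a.
by right; exists s; split=> //; exact: ltnW.
Qed.

Definition adapted p (c : 'I_N -> R) : Prop :=
  (forall j, 0 < c j <= 2^-1) /\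
  (forall x, 0 < dist_int (p x) < 2^-1 -> exists j, dist_int (p x) = c j).

Lemma exists_adapted p : exists c, adapted p c.
Proof.
pose S : set R := [set a | 0 < a < 2^-1 /\ exists x, dist_int (p x) = a].
have [[s [sn us sS]]|[s [sn sS Ss]]] := finite_or_many S N.+1.
  have /choice[x xP] : forall i : 'I_N.+1, exists x, dist_int (p x) = s`_i.
    by move=> i; apply: (sS _ _).2; rewrite mem_nth ?sn.
  exfalso; apply: (@hull_values_bound p x) => [i|i j].
    by rewrite xP; apply: (sS _ _).1; rewrite mem_nth ?sn.
  by rewrite !xP => /eqP; rewrite nth_uniq ?sn// => /eqP/val_inj.
exists (fun j => nth 2^-1 s j); split => [j|x px].
  have [js|js] := ltnP j (size s).
    by have [/andP[-> /ltW->]] := sS _ (mem_nth 2^-1 js).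
  by rewrite nth_default// invr_gt0 ltr0n lexx.
have pxs : dist_int (p x) \in s by apply: Ss; split => //; exists x.
have iN : (index (dist_int (p x)) s < N)%N.
  by rewrite -ltnS; apply: leq_trans sn; rewrite !ltnS index_mem.
by exists (Ordinal iN); rewrite /= nth_index.
Qed.

Lemma adapted_cases p c x : adapted p c ->
  exists o : option (option 'I_N), dist_int (p x) =
    if o is Some o' then if o' is Some j then c j else 2^-1 else 0.
Proof.
move=> [_ pc]; have /andP[] := dist_int_itv (p x).
rewrite le_eqVlt => /predU1P[<- _|x0]; first by exists None.
rewrite le_eqVlt => /predU1P[->|x2]; first by exists (Some None).
by have [|j ->] := pc x; [rewrite x0 x2|exists (Some (Some j))].
Qed.

(** For fixed [x] the excess [p x + p y - d(x, y)] takes finitely many values modulo 1, so a small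
    enough excess is 0. *)
Lemma adapted_tight p c : adapted p c -> tight p.
Proof.
move=> pc x.
pose off (ob : option (option 'I_N) * bool) : R := (-1) ^+ ob.2 *
  if ob.1 is Some o' then if o' is Some j then c j else 2^-1 else 0.
pose frac (a : R) := a - (Num.floor a)%:~R.
have frac_itv a : 0 <= frac a < 1.
  have := floor_itv a; rewrite intrD /frac => /andP[? ?].
  by apply/andP; split; lra.
(* The value 1 stands in for a zero fractional part, so that an integral excess below [d] is 0. *)
have [|d d0 dP] := @finite_pos_lbound R _ (fun ob =>
    if frac (p x + off ob) == 0 then 1 else frac (p x + off ob)).
  move=> ob; case: eqP => // /eqP; rewrite lt_def => ->.
  by have /andP[] := frac_itv (p x + off ob).
have [y pxy] := hull_near p x d0; exists y.
have pge := hull_ge p x y.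
have [sj [k py]] : exists ob, exists k : int, p y = k%:~R + off ob.
  have [j jE] := adapted_cases y pc.
  by case: (dist_intP (p y)) => ->; rewrite jE; [exists (j, false)|exists (j, true)];
    exists (nearest_int (p y)); rewrite /off /= ?expr0 ?expr1 ?mul1r ?mulN1r.
have := dP sj; set a := p x + off sj.
pose z := Num.floor a + k - (gdist x y : int).
have zE : p x + p y - (gdist x y)%:R = frac a + z%:~R.
  by rewrite /z intrB intrD py /frac /a -pmulrn; lra.
have /andP[fa0 fa1] := frac_itv a.
have z0 : 0 <= z.
  have : (-1)%:~R < z%:~R :> R by rewrite mulrN1z; lra.
  by rewrite ltr_int; lia.
have zR : 0 <= z%:~R :> R by rewrite ler0z.
case: eqP => [fa d1|_]; last by lra.
suff z00 : z = 0 by apply/eqP; rewrite -subr_eq0 zE fa z00 mulr0z addr0.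
have : z%:~R < 1%:~R :> R by rewrite mulr1z; lra.
by rewrite ltr_int; lia.
Qed.

End hull_values.

(** * The infimum of the displacement is attained *)

Lemma fold_id (R : realType) (u : R -> R) (a : R) :
  u (dist_int a) = dist_int a -> fold u a = a.
Proof.
by move=> ua; rewrite /fold ua /dist_int -numEsg addrC subrK.
Qed.

Section steps.
Variables (R : realType) (N : nat).
Implicit Types (c : 'I_N -> R) (w : 'rV[R]_N).

(** A running maximum is monotone for every [w], so the whole cube [box 2^-1] can serve as compact
    parameter space. *)
Definition step c w (r : R) : R :=
  if r < 2^-1 then \big[Num.max/0]_(j | c j <= r) w ord0 j else 2^-1.

Lemma step_folding c w : (forall j, 0 < c j) -> box 2^-1 w -> folding (step c w).
Proof.
move=> c0 bw; rewrite /folding /step ltxx invr_gt0 ltr0n; split=> //.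
  by rewrite big_pred0// => j; rewrite leNgt c0.
move=> r s r0 rs s2; case: ltP => [r2|r2]; last first.
  by rewrite ltNge (le_trans r2 rs).
case: ltP => _.
  apply/bigmax_leP; split => [|j jr]; first exact: bigmax_ge_id.
  by apply: le_bigmax_cond; exact: le_trans jr rs.
apply/bigmax_leP; split => [|j jr]; first by rewrite invr_ge0.
by have /andP[] := bw j.
Qed.

Lemma step_le c w w' (e r : R) : 0 <= e ->
  (forall j, `|w ord0 j - w' ord0 j| <= e) -> `|step c w r - step c w' r| <= e.
Proof.
move=> e0 ww'; rewrite /step; case: ltP => _; last by rewrite subrr normr0.
have half (v v' : 'rV[R]_N) : (forall j, v ord0 j <= v' ord0 j + e) ->
    \big[Num.max/0]_(j | c j <= r) v ord0 j <=
    \big[Num.max/0]_(j | c j <= r) v' ord0 j + e.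
  move=> vv'; apply/bigmax_leP; split => [|j jr].
    by rewrite addr_ge0// bigmax_ge_id.
  by apply: le_trans (vv' j) _; rewrite lerD2r le_bigmax_cond.
have : forall j, w ord0 j <= w' ord0 j + e.
  by move=> j; have := ww' j; rewrite ler_norml => /andP[? ?]; lra.
have : forall j, w' ord0 j <= w ord0 j + e.
  by move=> j; have := ww' j; rewrite ler_norml => /andP[? ?]; lra.
by move=> /half h2 /half h1; rewrite ler_norml; apply/andP; split; lra.
Qed.

(** Apart from the nearest integer, [fold (step c w) a] depends on [a] only through this finite
    data: the sign, the thresholds reached, and whether 1/2 is reached. *)
Definition level c (a : R) : bool * ({set 'I_N} * bool) :=
  (a < (nearest_int a)%:~R,
   ([set j | c j <= dist_int a]%SET, dist_int a < 2^-1)).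

Definition level_val w (l : bool * ({set 'I_N} * bool)) : R :=
  (-1) ^+ l.1 * (if l.2.2 then \big[Num.max/0]_(j in l.2.1) w ord0 j else 2^-1).

Lemma fold_step c w a : (forall j, 0 < c j) ->
  fold (step c w) a = (nearest_int a)%:~R + level_val w (level c a).
Proof.
move=> c0; rewrite /fold /level_val /level /=; congr (_ + _).
rewrite /step.
under [in RHS]eq_bigl do rewrite inE.
have [ak|ak|ak] := ltgtP a (nearest_int a)%:~R.
- by rewrite ltr0_sg ?subr_lt0// expr1.
- by rewrite gtr0_sg ?subr_gt0// expr0.
(* At an integer [level] records a positive sign, but no [c j] is at most 0, so the maximum is 0 as
   well. *)
- rewrite -ak subrr sgr0 mul0r expr0 mul1r /dist_int -ak subrr normr0.
  rewrite invr_gt0 ltr0n big_pred0// => j; by rewrite leNgt c0.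
Qed.

End steps.

(** * Finitely many types of displacement *)

Section displacement_types.
Variables (R : realType) (X : connected_graph) (N B : nat) (g : graph_aut X).
Implicit Types (p q : injective_hull R X) (c : 'I_N -> R) (w : 'rV[R]_N).

Let levels := (bool * ({set 'I_N} * bool))%type.
Let code_type := ('I_B.*2.+1 * levels * levels)%type.

(** The difference of nearest integers is shifted by [B] to fit into an ordinal; [code_val] undoes
    the shift. *)
Definition code p c x : code_type :=
  (inord (absz (nearest_int (p (aut_inv g x)) - nearest_int (p x) + B%:Z)),
   level c (p (aut_inv g x)), level c (p x)).

Definition code_val w (t : code_type) : R :=
  (t.1.1 : nat)%:R - B%:R + level_val w t.1.2 - level_val w t.2.

(* By fold_code, the displacement of fold (step c w) \o p depends on p and c
   only through this subset of a finite type. *)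
Definition codes p c : {set code_type} :=
  [set t | `[< exists x, code p c x = t >]]%SET.

Lemma fold_code p c w x : (forall j, 0 < c j) ->
  displacement g p <= B%:R - 1 ->
  fold (step c w) (p (aut_inv g x)) - fold (step c w) (p x) =
  code_val w (code p c x).
Proof.
move=> c0 pB; rewrite !fold_step// /code_val /code /=.
set k' := nearest_int (p (aut_inv g x)); set k := nearest_int (p x).
have := le_trans (displacement_ge g p x) pB; rewrite ler_norml => /andP[? ?].
have /andP[? ?] := nearest_int_itv (p (aut_inv g x)).
have /andP[? ?] := nearest_int_itv (p x).
(* Rounding moves each value by at most 1/2, so the integers differ by at most the displacement plus
   1. *)
have kB : - (B%:Z) <= k' - k <= B%:Z.
  rewrite -!(ler_int R) intrN intrB -!pmulrn.
  by rewrite /k /k'; apply/andP; split; lra.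
rewrite inordK; last by lia.
have -> : (absz (k' - k + B%:Z))%:R = k'%:~R - k%:~R + B%:R :> R.
  by rewrite natr_absz ger0_norm; [rewrite intrD intrB|lia].
by lra.
Qed.

(** Both displacements are suprema of [code_val w] in absolute value over the same set of codes. *)
Lemma displacement_codes p c p' c' w q q' :
  (forall j, 0 < c j) -> (forall j, 0 < c' j) ->
  displacement g p <= B%:R - 1 -> displacement g p' <= B%:R - 1 ->
  q = fold (step c w) \o p :> (X -> R) ->
  q' = fold (step c' w) \o p' :> (X -> R) ->
  codes p c = codes p' c' -> displacement g q <= displacement g q'.
Proof.
move=> c0 c'0 pB p'B qE q'E pp'.
apply: displacement_le => [|x]; first exact: displacement_ge0.
rewrite qE /= fold_code//.
have : code p c x \in codes p' c'.
  by rewrite -pp' inE; apply/asboolP; exists x.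
rewrite inE => /asboolP[y <-].
by have := displacement_ge g q' y; rewrite q'E /= fold_code.
Qed.

End displacement_types.

Lemma displacement_lipschitz (R : realType) (X : connected_graph)
    (g : graph_aut X) (p q : injective_hull R X) (e : R) : 0 <= e ->
  (forall x, `|p x - q x| <= e) -> displacement g p <= displacement g q + 2 * e.
Proof.
move=> e0 pq; apply: displacement_le => [|x].
  by rewrite addr_ge0 ?displacement_ge0// mulr_ge0.
have := displacement_ge g q x; have := pq x; have := pq (aut_inv g x).
by rewrite !ler_norml => /andP[? ?] /andP[? ?] /andP[? ?]; apply/andP; split; lra.
Qed.

Section minimum.
Variables (R : realType) (X : connected_graph) (N : nat) (g : graph_aut X).
Hypothesis dimN : covering_dim_le (injective_hull R X) N.
Implicit Types (p q : injective_hull R X).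

Let L := inf (range (@displacement R X g)).

(** Among the entries of [c] up to [c j] the largest is [c j] itself, so the parameter [c] gives
    back [p]. *)
Lemma step_adapted p (c : 'I_N -> R) x : adapted p c ->
  step c (\row_j c j) (dist_int (p x)) = dist_int (p x).
Proof.
move=> pc; have [c02 px] := pc; have /andP[] := dist_int_itv (p x).
rewrite /step le_eqVlt => /predU1P[<- _|x0].
  by rewrite invr_gt0 ltr0n big_pred0// => j; rewrite leNgt; have /andP[->] := c02 j.
rewrite le_eqVlt => /predU1P[->|x2]; first by rewrite ltxx.
rewrite x2; have [|j xj] := px x; first by rewrite x0 x2.
apply/eqP; rewrite eq_le; apply/andP; split.
  by apply/bigmax_leP; split => [|i ci]; [exact: ltW|rewrite mxE].
rewrite {1}xj; have -> : c j = (\row_j c j) ord0 j by rewrite mxE.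
by apply: le_bigmax_cond; rewrite xj.
Qed.

Lemma displacement_inf p : L <= displacement g p.
Proof.
apply: ge_inf; last by exists p.
by exists 0 => _ [q _ <-]; exact: displacement_ge0.
Qed.

Lemma displacement_inf_near p0 (e : R) : 0 < e -> exists p, displacement g p < L + e.
Proof.
move=> e0; have [|_ [p _ <-] pe] := @inf_adherent R (range (@displacement R X g)) _ e0.
  split; first by exists (displacement g p0), p0.
  by exists 0 => _ [q _ <-]; exact: displacement_ge0.
by exists p.
Qed.

Lemma displacement_min p0 : minimal_set R g !=set0.
Proof.
have L0 : 0 <= L.
  apply: lb_le_inf; first by exists (displacement g p0), p0.
  by move=> _ [q _ <-]; exact: displacement_ge0.
pose B := (Num.bound L).+2.
have LB : L + 1 <= B%:R - 1.
  by have := archi_boundP L0; rewrite /B -!natr1; lra.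
(* Pigeonhole over the finitely many sets of codes: if each [T] stayed above the infimum by its own
   gap [E T], the least gap would contradict the infimum. *)
have [T TP] : exists T, forall e, 0 < e -> exists p, exists c : 'I_N -> R, [/\ adapted p c,
    displacement g p <= B%:R - 1, displacement g p < L + e &
    codes B g p c = T].
  apply: contrapT => noT.
  have /choice[E EP] : forall T, exists e, 0 < e /\ forall p (c : 'I_N -> R),
      adapted p c -> displacement g p <= B%:R - 1 ->
      codes B g p c = T -> L + e <= displacement g p.
    move=> T; apply: contrapT => noe; apply: noT; exists T => e e0.
    apply: contrapT => nopc; apply: noe; exists e; split => // p c pc pB pT.
    by rewrite leNgt; apply/negP => pe; apply: nopc; exists p, c.
  have [e e0 eP] := finite_pos_lbound (fun T => (EP T).1).
  have [|p] := @displacement_inf_near p0 (Num.min e 1); first by rewrite lt_min e0/=.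
  have [c pc] := exists_adapted dimN p.
  rewrite -ltrBlDl lt_min !ltrBlDl => /andP[pe p1].
  have pB : displacement g p <= B%:R - 1 by apply: le_trans LB; exact: ltW.
  have := (EP (codes B g p c)).2 p c pc pB erefl; rewrite leNgt => /negP[].
  by apply: lt_le_trans pe _; rewrite lerD2l.
(* One representative [p1] of the type carries the whole family [mv]. *)
have [p1 [c1 [pc1 p1B _ p1T]]] := TP _ ltr01.
have tp1 := adapted_tight pc1.
have c0 (p : injective_hull R X) (c : 'I_N -> R) : adapted p c -> forall j, 0 < c j.
  by move=> [c02 _] j; have /andP[] := c02 j.
have /choice[mv mvE] : forall w : 'rV[R]_N, exists q : injective_hull R X,
    box 2^-1 w -> q = fold (step c1 w) \o p1 :> (X -> R).
  move=> w; have [bw|] := pselect (box 2^-1 w); last by exists p1.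
  have [q qE] := hull_fold_tight tp1 (step_folding (c0 _ _ pc1) bw).
  by exists q.
pose D w := displacement g (mv w).
have Dlip w w' e : 0 <= e -> box 2^-1 w -> box 2^-1 w' ->
    (forall j, `|w ord0 j - w' ord0 j| <= e) -> D w <= D w' + 2 * e.
  move=> e0 bw bw' ww'; apply: displacement_lipschitz => // x.
  rewrite mvE// mvE//=; apply: le_trans (fold_dist_le _ _ _) _.
  exact: step_le.
have row_box p (c : 'I_N -> R) : adapted p c -> box 2^-1 (\row_j c j).
  by move=> [c02 _] j; rewrite mxE; have /andP[/ltW-> ->] := c02 j.
have box0 : @box R N 2^-1 !=set0 by exists (\row_j c1 j); exact: row_box pc1.
have contD : {within @box R N 2^-1, continuous D}.
  apply/subspace_continuousP => w bw; apply/cvgrPdist_le => e e0.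
  have e20 : 0 < e / 2 by rewrite divr_gt0.
  have : \forall w' \near w, ball w (e / 2) w' by exact: nbhsx_ballx.
  apply: filterS => w' [_ ww'] bw'.
  have wle j : `|w ord0 j - w' ord0 j| <= e / 2 by exact/ltW/ww'.
  have h1 := Dlip w w' _ (ltW e20) bw bw' wle.
  have wle' j : `|w' ord0 j - w ord0 j| <= e / 2 by rewrite distrC.
  have h2 := Dlip w' w _ (ltW e20) bw' bw wle'.
  rewrite -[from_subspace _ _ w]/(D w) -[from_subspace _ _ w']/(D w').
  by rewrite ler_norml; apply/andP; split; lra.
have [w /set_mem bw wmin] := EVT_min_rV box0 (@box_compact R N _) contD.
exists (mv w); rewrite /minimal_set /= -/L; apply/eqP.
rewrite eq_le displacement_inf andbT; apply/ler_addgt0Pr => e e0.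
(* Having the same codes as [p1], the point [p] is displaced at least as much as [mv] at the
   parameter [c]. *)
have [p [c [pc pB pe pT]]] := TP e e0.
apply: le_trans (ltW pe).
have /wmin := mem_set (row_box _ _ pc); move=> /le_trans; apply.
apply: (@displacement_codes R X N B g p1 c1 p c (\row_j c j) _ _
  (c0 _ _ pc1) (c0 _ _ pc) p1B pB); last by rewrite p1T.
- by rewrite mvE//; exact: row_box pc.
- by apply/funext => x /=; rewrite fold_id//; exact: step_adapted pc.
Qed.

End minimum.

(** * Averaging and translation length *)

Section retraction.
Variables (R : realType) (X : connected_graph).
Implicit Types (f : X -> R).

Definition dominating f : Prop := forall x y, (gdist x y)%:R <= f x + f y.

Definition conjugate f (x : X) : R := sup (range (fun y => (gdist x y)%:R - f y)).

(** The conjugate alone may fail to dominate. Its average with [f] does, because [f] at one point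
    plus the conjugate at the other is at least their distance. *)
Definition half_step f (x : X) : R := (f x + conjugate f x) / 2.

Lemma dominating_ge0 f x : dominating f -> 0 <= f x.
Proof. by move=> /(_ x x); rewrite gdistxx; lra. Qed.

Lemma conjugate_ge f x y : dominating f -> (gdist x y)%:R - f y <= conjugate f x.
Proof.
move=> fd; apply: ub_le_sup; last by exists y.
by exists (f x) => _ [z _ <-]; rewrite lerBlDr; exact: fd.
Qed.

Lemma conjugate_le f x (c : R) :
  (forall y, (gdist x y)%:R - f y <= c) -> conjugate f x <= c.
Proof.
move=> fc; apply: ge_sup; first by exists ((gdist x x)%:R - f x), x.
by move=> _ [y _ <-].
Qed.

Lemma conjugate_le_self f x : dominating f -> conjugate f x <= f x.
Proof. by move=> fd; apply: conjugate_le => y; have := fd x y; lra. Qed.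

Lemma half_step_le f x : dominating f -> half_step f x <= f x.
Proof. by move=> /(@conjugate_le_self _ x); rewrite /half_step; lra. Qed.

Lemma half_step_dominating f : dominating f -> dominating (half_step f).
Proof.
move=> fd x y; rewrite /half_step.
have := conjugate_ge x y fd; have := conjugate_ge y x fd.
by rewrite (gdistC y x); lra.
Qed.

(** Conjugation reverses order, so lowering [f] raises the conjugate, while averaging already halves
    the gap. *)
Lemma half_step_gap f x : dominating f ->
  half_step f x - conjugate (half_step f) x <= (f x - conjugate f x) / 2.
Proof.
move=> fd; have : conjugate f x <= conjugate (half_step f) x; last first.
  by move=> ?; rewrite {1}/half_step; lra.
apply: conjugate_le => y.
apply: le_trans (conjugate_ge x y (half_step_dominating fd)).
by rewrite lerD2l lerN2 half_step_le.
Qed.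

(** Automorphisms preserve distances, so conjugation commutes with them and does not increase the
    displacement. *)
Lemma half_step_displacement (g : graph_aut X) f (D : R) : dominating f ->
  (forall x, `|f (aut_inv g x) - f x| <= D) ->
  forall x, `|half_step f (aut_inv g x) - half_step f x| <= D.
Proof.
move=> fd fD x.
have c1 : conjugate f (aut_inv g x) <= conjugate f x + D.
  apply: conjugate_le => y; have := conjugate_ge x (g y) fd.
  rewrite -{1}(aut_invK g x) gdist_aut.
  by have := fD (g y); rewrite aut_funK ler_norml => /andP[? ?]; lra.
have c2 : conjugate f x <= conjugate f (aut_inv g x) + D.
  apply: conjugate_le => y; have := conjugate_ge (aut_inv g x) (aut_inv g y) fd.
  rewrite -(gdist_aut g) !aut_invK.
  by have := fD y; rewrite ler_norml => /andP[? ?]; lra.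
have := fD x; rewrite /half_step !ler_norml => /andP[? ?].
by apply/andP; split; lra.
Qed.

(* The equivariant retraction onto the hull, applied to f: the gap between f
   and its conjugate is halved at each step. *)
Lemma dominating_retract (g : graph_aut X) f (D : R) : 0 <= D -> dominating f ->
  (forall x, `|f (aut_inv g x) - f x| <= D) ->
  exists p : injective_hull R X, displacement g p <= D.
Proof.
move=> D0 fd fD; pose F k := iter k half_step f.
have Fd k : dominating (F k) by elim: k => //= k; exact: half_step_dominating.
have FD k x : `|F k (aut_inv g x) - F k x| <= D.
  by elim: k x => //= k IH; exact: half_step_displacement.
have Fle k l x : (k <= l)%N -> F l x <= F k x.
  elim: l => [|l IH]; first by rewrite leqn0 => /eqP->.
  rewrite leq_eqVlt => /predU1P[->//|]; rewrite ltnS => /IH.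
  exact/le_trans/half_step_le.
have Fgap k x : (F k x - conjugate (F k) x) * 2 ^+ k <= f x - conjugate f x.
  elim: k => [|k]; first by rewrite expr0 mulr1.
  apply: le_trans; rewrite exprS mulrA ler_pM2r ?exprn_gt0//.
  by have := half_step_gap x (Fd k); rewrite -[F k.+1]/(half_step (F k)); lra.
(* The iterates decrease, so their infimum is their pointwise limit. *)
pose I x := inf (range (fun k => F k x)).
have inf_le k x : I x <= F k x.
  apply: ge_inf; last by exists k.
  by exists 0 => _ [l _ <-]; exact: dominating_ge0.
have inf_ge (c : R) x : (forall k, c <= F k x) -> c <= I x.
  by move=> cF; apply: lb_le_inf; [exists (F 0%N x), 0%N|move=> _ [k _ <-]].
have [x y|x e e0|p pI] := @hull_near_exists R X I.
- rewrite -lerBlDr; apply: (inf_ge _ _) => k; rewrite lerBlDr -lerBlDl.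
  apply: (inf_ge _ _) => l; rewrite lerBlDl; apply: le_trans (Fd (maxn k l) x y) _.
  by rewrite lerD ?Fle ?leq_maxl ?leq_maxr.
- set gap := f x - conjugate f x.
  have gap0 : 0 <= gap by rewrite subr_ge0; exact: conjugate_le_self.
  have e2 : 0 < e / 2 by rewrite divr_gt0.
  (* After [k] halvings the gap at [x] is below [e / 2]; the other half is spent on a near-maximizer
     [y] of the conjugate. *)
  pose k := Num.bound (gap / (e / 2)).
  have kgap : F k x - conjugate (F k) x < e / 2.
    have : gap / (e / 2) < 2 ^+ k.
      apply: lt_le_trans (archi_boundP _) _; first by rewrite divr_ge0// ltW.
      by rewrite -natrX ler_nat ltnW// ltn_expl.
    rewrite ltr_pdivrMr// mulrC => /(le_lt_trans (Fgap k x)).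
    by rewrite ltr_pM2r// exprn_gt0.
  have [|_ [y _ <-] yk] := @sup_adherent R
      (range (fun y => (gdist x y)%:R - F k y)) _ e2.
    split; first by exists ((gdist x x)%:R - F k x), x.
    by exists (F k x) => _ [z _ <-]; rewrite lerBlDr; exact: Fd.
  exists y; have := inf_le k x; have := inf_le k y.
  by move: yk; rewrite -/(conjugate (F k) x); lra.
exists p; apply: displacement_le => // x; rewrite pI.
have h1 : I (aut_inv g x) - D <= I x.
  apply: (inf_ge _ _) => k; have := inf_le k (aut_inv g x); have := FD k x.
  by rewrite ler_norml => /andP[? ?]; lra.
have h2 : I x - D <= I (aut_inv g x).
  apply: (inf_ge _ _) => k; have := inf_le k x; have := FD k x.
  by rewrite ler_norml => /andP[? ?]; lra.
by rewrite ler_norml; apply/andP; split; lra.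
Qed.

End retraction.

(** * Orbits and translation length *)

Section aut_iter.
Variables (X : connected_graph) (g : graph_aut X).

Lemma aut_iterS (m : int) x : aut_iter g (m + 1) x = g (aut_iter g m x).
Proof.
case: m => [m|[|m]].
- by rewrite -[1]/(1%:Z) -PoszD addn1.
- by rewrite /= aut_invK.
- have -> : Negz m.+1 + 1 = Negz m by lia.
  by rewrite /= aut_invK.
Qed.

Lemma gdist_aut_iter (m : int) (k : nat) x :
  gdist (aut_iter g (m + k%:Z) x) (aut_iter g m x) = gdist (iter k g x) x.
Proof.
have step (a b : int) : gdist (aut_iter g (a + 1) x) (aut_iter g (b + 1) x) =
    gdist (aut_iter g a x) (aut_iter g b x) by rewrite !aut_iterS gdist_aut.
elim/int_ind: m => [|m IH|m IH]; first by rewrite add0r.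
- by rewrite -IH -[RHS]step; congr (gdist (aut_iter _ _ _) (aut_iter _ _ _)); lia.
- by rewrite -IH -[LHS]step; congr (gdist (aut_iter _ _ _) (aut_iter _ _ _)); lia.
Qed.

Lemma gdist_iter (k : nat) x y :
  gdist (iter k (aut_inv g) y) x = gdist y (iter k g x).
Proof.
elim: k x y => //= k IH x y.
by rewrite -(gdist_aut g) aut_invK IH -iterSr.
Qed.

Lemma gdist_iter_le (k : nat) x : (gdist (iter k g x) x <= k * gdist (g x) x)%N.
Proof.
elim: k => [|k IH]; first by rewrite gdistxx.
apply: leq_trans (gdist_triangle (iter k g x) _ _) _.
rewrite mulSn leq_add//.
by elim: k {IH} => //= k; rewrite gdist_aut.
Qed.

End aut_iter.

Section translation_length.
Variables (R : realType) (X : connected_graph) (g : graph_aut X).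
Implicit Types (p : injective_hull R X).

(* Averaging p over its first n translates divides by n the displacement of
   the n-th power. *)
Lemma displacement_power p (n : nat) (L K : R) : (0 < n)%N -> 0 <= K ->
  (forall q : injective_hull R X, L <= displacement g q) ->
  (forall x, `|p (iter n (aut_inv g) x) - p x| <= K) -> n%:R * L <= K.
Proof.
move=> n0 K0 Lmin pK; have nR : 0 < n%:R :> R by rewrite ltr0n.
pose f x : R := n%:R^-1 * \sum_(0 <= i < n) p (iter i (aut_inv g) x).
have [|x y|x|q qK] := @dominating_retract R X g f (n%:R^-1 * K).
- by rewrite mulr_ge0 ?invr_ge0 ?ler0n.
- rewrite -mulrDr -big_split /= ler_pdivlMl// mulr_natl.
  rewrite -[X in _ *+ X](subn0 n) -sumr_const_nat; apply: ler_sum_nat => i _.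
  suff <- : gdist (iter i (aut_inv g) x) (iter i (aut_inv g) y) = gdist x y.
    exact: hull_ge.
  by elim: i => //= i <-; rewrite -(gdist_aut g) !aut_invK.
- rewrite -mulrBr normrM ger0_norm ?invr_ge0 ?ler0n// ler_pM2l ?invr_gt0//.
  rewrite -sumrB (eq_bigr (fun i => p (iter i.+1 (aut_inv g) x) -
    p (iter i (aut_inv g) x))) => [|i _]; last by rewrite iterSr.
  by rewrite telescope_sumr// iterS.
- by have := le_trans (Lmin q) qK; rewrite ler_pdivlMl.
Qed.

(** The point [p] lies at distance [p x] from the image of [x] in the hull, so passing from [x] to
    [p] changes the displacement of the [n]-th power by at most [2 * p x]. *)
Lemma hull_iter_sub p (n : nat) x y :
  `|p (iter n (aut_inv g) y) - p y| <= (gdist (iter n g x) x)%:R + 2 * p x.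
Proof.
have := hull_lipschitz p (iter n (aut_inv g) y) x.
have := hull_ge p (iter n (aut_inv g) y) x; rewrite !gdist_iter.
have := hull_lipschitz p y x; have := hull_ge p y x.
have := gdist_triangle x y (iter n g x).
have := gdist_triangle (iter n g x) y x.
rewrite (gdistC x (iter n g x)) -!(ler_nat R) !natrD ler_norml => *.
by apply/andP; split; lra.
Qed.

(** A fixed [p] is constant along the orbit of [x], so orbit points are at most [p x + p x]
    apart. *)
Lemma elliptic_fixed p : displacement g p = 0 -> elliptic g.
Proof.
move=> p0 x.
have pinv y : p (aut_inv g y) = p y.
  have := displacement_ge g p y; rewrite p0 normr_le0 subr_eq0.
  by move=> /eqP.
have pit (m : int) : p (aut_iter g m x) = p x.
  case: m => k /=.
    by elim: k => //= k <-; rewrite -[in RHS](aut_funK g (iter k g x)) pinv.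
  rewrite pinv; elim: k => //= k <-; by rewrite pinv.
have p2 : 0 <= p x + p x by have := hull_ge p x x; rewrite gdistxx.
exists (Num.bound (p x + p x)) => m n; rewrite -(ler_nat R).
apply: le_trans (hull_ge p _ _) _; rewrite !pit; apply: ltW.
exact: archi_boundP.
Qed.

Lemma hyperbolic_translation p (L : R) (x : X) : 0 < L ->
  (forall q : injective_hull R X, L <= displacement g q) -> hyperbolic R g.
Proof.
move=> L0 Lmin; exists x.
have px0 : 0 <= p x by have := hull_ge p x x; rewrite gdistxx; lra.
have low (k : nat) : L * k%:R <= (gdist (iter k g x) x)%:R + 2 * p x.
  case: k => [|k].
    by rewrite mulr0 gdistxx add0r mulr_ge0.
  rewrite mulrC; apply: (displacement_power _ _ Lmin) => // [|y].
    by rewrite addr_ge0// mulr_ge0.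
  exact: hull_iter_sub.
pose d : R := (gdist (g x) x)%:R.
have d0 : 0 <= d by exact: ler0n.
have up (k : nat) : (gdist (iter k g x) x)%:R <= d * k%:R.
  by rewrite /d -natrM ler_nat mulnC gdist_iter_le.
(* A single constant with [1 <= M], [M^-1 <= L] and [d <= M]. *)
pose M := 1 + L^-1 + d.
have Li : 0 < L^-1 by rewrite invr_gt0.
have M0 : 0 < M by rewrite /M; lra.
have ML : M^-1 <= L by rewrite -[L]invrK lef_pV2 ?posrE// /M; lra.
have key (k : nat) : M^-1 * k%:R - 2 * p x <= (gdist (iter k g x) x)%:R
    <= M * k%:R + 2 * p x.
  have k0 : 0 <= k%:R :> R by exact: ler0n.
  have h1 : M^-1 * k%:R <= L * k%:R by exact: ler_wpM2r.
  have h2 : d * k%:R <= M * k%:R by apply: ler_wpM2r => //; rewrite /M; lra.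
  by have := low k; have := up k; move=> ? ?; apply/andP; split; lra.
exists M, (2 * p x); split; [by rewrite /M; lra|by rewrite mulr_ge0|].
have {}key (m n : int) : n <= m -> M^-1 * `|m - n|%:~R - 2 * p x <=
    (gdist (aut_iter g m x) (aut_iter g n x))%:R <= M * `|m - n|%:~R + 2 * p x.
  move=> nm; have [k mk] : exists k : nat, m = n + k%:Z.
    by exists (absz (m - n)); lia.
  by rewrite mk gdist_aut_iter addrAC subrr add0r; exact: key.
move=> m n; case: (leP n m) => [|/ltW] /key //.
by rewrite distrC gdistC.
Qed.

End translation_length.

(** The Kuratowski embedding, where every supremum is attained at [x]; it supplies a point of the
    hull. *)
Lemma gdist_hull (R : realType) (X : connected_graph) (x : X) :
  exists p : injective_hull R X, forall y, p y = (gdist x y)%:R.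
Proof.
have [y z|y e e0|p pE] := @hull_near_exists R X (fun y => (gdist x y)%:R).
- by rewrite -natrD ler_nat (gdistC x y) gdist_triangle.
- by exists x; rewrite gdistxx addr0 (gdistC x y) ltrDl.
- by exists p => y; rewrite pE.
Qed.

Theorem theorem5p3 (R : realType) (X : connected_graph)
    (hX : helly_graph X) (hdim : finite_combinatorial_dim R X) :
  (forall g : graph_aut X, elliptic g \/ hyperbolic R g) /\
  (forall g : graph_aut X, minimal_set R g !=set0).
Proof.
(* The Helly property of the empty family of balls yields a vertex. *)
have [x _] : \bigcap_(a in set0) gball (X := X) a.1 a.2 !=set0 by apply: hX.
have [p0 _] := gdist_hull R x; have [N dimN] := hdim.
have minP g : minimal_set R g !=set0 := displacement_min g dimN p0.
split=> // g; have [p pmin] := minP g.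
have Lmin q : displacement g p <= displacement g q.
  by rewrite pmin; exact: displacement_inf.
have := displacement_ge0 g p; rewrite le_eqVlt => /predU1P[p00|pL].
  by left; exact: (@elliptic_fixed R X g p).
by right; exact: hyperbolic_translation pL Lmin.
Qed.
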